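(* Let $K$ be a perfect field, let $n\ge1$, let $\mathbb{X}$ be a 0-dimensional scheme in $\mathbb{P}^n_K$ with homogeneous vanishing ideal $I_{\mathbb{X}}\subseteq P=K[X_0,\dots,X_n]$ and homogeneous coordinate ring $R=P/I_{\mathbb{X}}$, and let $\mathbb{Y}$ be the differential fattening of $\mathbb{X}$, with homogeneous vanishing ideal $I_{\mathbb{Y}}$. Then the sequence of graded $R$-modules $$ 0\longrightarrow I_{\mathbb{X}}/I_{\mathbb{Y}}\stackrel{\delta}{\longrightarrow}R^{n+1}(-1)\stackrel{\gamma}{\longrightarrow}\Omega^1_R\longrightarrow 0 $$ is exact, where $\delta(f+I_{\mathbb{Y}})=\sum_{i=0}^n\frac{\partial f}{\partial x_i}\,e_i$ for every homogeneous polynomial $f\in I_{\mathbb{X}}$, and $\gamma(e_i)=dx_i$ for $i=0,\dots,n$.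
   Context: $P$ is standard graded. The homogeneous vanishing ideal of a 0-dimensional (closed sub)scheme of $\mathbb{P}^n_K$ is the saturated homogeneous ideal of $P$ defining it. $x_i$ is the image of $X_i$ in $R$; $\frac{\partial f}{\partial x_i}$ denotes the image in $R$ of $\frac{\partial f}{\partial X_i}$; $e_0,\dots,e_n$ is the canonical basis of $R^{n+1}(-1)$, with each $e_i$ in degree $1$. $\Omega^1_R=\Omega^1_{R/K}$ is the (graded) module of Kähler differentials of $R/K$, with universal derivation $d$ and $\deg(dx_i)=1$. $K$-linear differential operators on $P$: $D_P^0=\operatorname{Hom}_P(P,P)$, and for $m\ge1$, $D_P^m=\{\delta\in\operatorname{Hom}_K(P,P)\mid \delta\circ\mu_f-\mu_f\circ\delta\in D_P^{m-1}\text{ for all } f\in P\}$, where $\mu_f$ is multiplication by $f$. Put $I_{\mathbb{X}}^{\mathrm{diff}}:=I_{\mathbb{X}}^{\langle2\rangle}=\{f\in P\mid\delta(f)\in I_{\mathbb{X}}\text{ for all }\delta\in D_P^1\}$. This is a saturated homogeneous ideal of $P$, and the 0-dimensional scheme $\mathbb{Y}\subseteq\mathbb{P}^n_K$ it defines is called the differential fattening of $\mathbb{X}$; thus $I_{\mathbb{Y}}=I_{\mathbb{X}}^{\mathrm{diff}}$. *)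

(* Defs.v *)
From HB Require Import structures.
From mathcomp Require Import all_boot all_algebra.
From mathcomp Require Import generic_quotient ring_quotient separable.
From mathcomp Require Import boolp mpoly.

Set Implicit Arguments.
Unset Strict Implicit.
Unset Printing Implicit Defensive.

Import GRing.Theory.

Local Open Scope ring_scope.
Local Open Scope quotient_scope.

Definition perfect_field (K : fieldType) : Prop :=
  forall p : {poly K}, irreducible_poly p -> separable_poly p.

(* [idealr R] is MathComp's structure of proper ideals, given by boolean
   membership predicates; in the presence of the axioms of [boolp] every proper
   ideal is of this form, so this is no restriction. *)

Section Ideals.
Variables (K : fieldType) (n : nat).
Local Notation P := {mpoly K[n]}.

Definition homogeneous_ideal (I : {pred P}) : Prop :=
  forall f d, f \in I -> pihomog mdeg d f \in I.

Definition saturated_ideal (I : {pred P}) : Prop :=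
  forall f k, (forall m : 'X_{1..n}, mdeg m = k -> 'X_[m] * f \in I) -> f \in I.

(* The points of Proj(P/I): homogeneous primes of P containing I but not the
   irrelevant ideal. *)
Definition proj_point (I : {pred P}) (p : prime_idealr P) : Prop :=
  [/\ homogeneous_ideal p, {subset I <= p} & exists i, 'X_i \notin p].

(* Proj(P/I) has Krull dimension 0: it is nonempty (so that dimension -1 is
   excluded), and there is no strict chain of two points. *)
Definition proj_dim0 (I : {pred P}) : Prop :=
  (exists p, proj_point I p) /\
  (forall p q, proj_point I p -> proj_point I q ->
     {subset p <= q} -> {subset q <= p}).

Fixpoint diffop (m : nat) (delta : P -> P) : Prop :=
  match m with
  | 0 => linear (delta : P^o -> P^o)
  | m'.+1 => linear delta /\
      forall f : P, diffop m' (fun g => delta (f * g) - f * delta g)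
  end.

(* I^<m>; the notion is used for m >= 1, as m.-1 is 0 for m = 0. *)
Definition diff_power (I : {pred P}) (m : nat) : {pred P} :=
  fun f => `[< forall delta, diffop m.-1 delta -> delta f \in I >].

Definition diff_ideal (I : {pred P}) : {pred P} := diff_power I 2.

End Ideals.

Section CoordinateRing.
Variables (K : fieldType) (n : nat) (I : idealr {mpoly K[n]}).
Local Notation P := {mpoly K[n]}.

Definition coord_ring : Type := {ideal_quot I}.
HB.instance Definition _ := GRing.ComNzRing.on coord_ring.

Definition coord_proj : P -> coord_ring := \pi_{ideal_quot I}.
HB.instance Definition _ := GRing.RMorphism.on coord_proj.

Lemma coord_projP (f g : P) : reflect (coord_proj f = coord_proj g) (f - g \in I).
Proof. by rewrite Quotient.idealrBE; apply: eqP. Qed.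

Lemma coord_reprK (r : coord_ring) : coord_proj (repr (r : {ideal_quot I})) = r.
Proof. exact: reprK. Qed.

Definition coord_scale (c : K) (r : coord_ring) : coord_ring :=
  coord_proj c%:MP * r.

Fact coord_scaleA a b r :
  coord_scale a (coord_scale b r) = coord_scale (a * b) r.
Proof. by rewrite /coord_scale mulrA -rmorphM mpolyCM. Qed.

Fact coord_scale1 : left_id 1 coord_scale.
Proof. by move=> r; rewrite /coord_scale mpolyC1 rmorph1 mul1r. Qed.

Fact coord_scaleDr : right_distributive coord_scale +%R.
Proof. by move=> a r s; rewrite /coord_scale mulrDr. Qed.

Fact coord_scaleDl r : {morph coord_scale^~ r : a b / a + b}.
Proof. by move=> a b; rewrite /coord_scale mpolyCD rmorphD mulrDl. Qed.

HB.instance Definition _ := GRing.Zmodule_isLmodule.Build K coord_ring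
  coord_scaleA coord_scale1 coord_scaleDr coord_scaleDl.

Lemma coord_scaleE (c : K) (r : coord_ring) : c *: r = coord_proj c%:MP * r.
Proof. by []. Qed.

Fact coord_scaleAl (a : K) (r s : coord_ring) : a *: (r * s) = (a *: r) * s.
Proof. exact: mulrA. Qed.

HB.instance Definition _ :=
  GRing.Lmodule_isLalgebra.Build K coord_ring coord_scaleAl.

Fact coord_scaleAr (a : K) (r s : coord_ring) : a *: (r * s) = r * (a *: s).
Proof. by rewrite mulrC coord_scaleAl mulrC. Qed.

HB.instance Definition _ :=
  GRing.Lalgebra_isAlgebra.Build K coord_ring coord_scaleAr.

Definition coord_var (i : 'I_n) : coord_ring := coord_proj 'X_i.

Definition coord_deriv (f : P) (i : 'I_n) : coord_ring :=
  coord_proj (f^`M(i)).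

End CoordinateRing.

(* The R-module I/I^diff, where R = P/I. *)
Section IdealModDiff.
Variables (K : fieldType) (n : nat) (I : idealr {mpoly K[n]}).
Local Notation P := {mpoly K[n]}.
Local Notation R := (coord_ring I).

Record ideal_elt := IdealElt { ideal_val :> P; ideal_valP : ideal_val \in I }.
HB.instance Definition _ := [isSub for ideal_val].
HB.instance Definition _ := [Choice of ideal_elt by <:].
HB.instance Definition _ := [SubChoice_isSubZmodule of ideal_elt by <:].

Definition in_diff : {pred ideal_elt} := [pred u | ideal_val u \in diff_ideal I].

Fact diffop_zmod m (delta : P -> P) : diffop m delta -> zmod_morphism delta.
Proof.
case: m => [|m] /= => [lin_d|[lin_d _]] f g.
  by have := lin_d (-1) g f; rewrite !scaleN1r ![- g + _]addrC ![- _ + _]addrC.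
by have := lin_d (-1) g f; rewrite !scaleN1r ![- g + _]addrC ![- _ + _]addrC.
Qed.

Fact in_diff_zmod : zmod_closed in_diff.
Proof.
split=> [|u v].
  apply/asboolP => delta /diffop_zmod D; have := D 0 0.
  by rewrite !subrr => ->; exact: rpred0.
move=> /asboolP Hu /asboolP Hv; apply/asboolP => delta D.
by rewrite (diffop_zmod D) rpredB ?Hu ?Hv.
Qed.
HB.instance Definition _ := GRing.isZmodClosed.Build ideal_elt in_diff in_diff_zmod.

Definition ideal_mod_diff : Type := {ideal_quot in_diff}.
HB.instance Definition _ := GRing.Zmodule.on ideal_mod_diff.

Definition diff_class : ideal_elt -> ideal_mod_diff := \pi_{ideal_quot in_diff}.
HB.instance Definition _ := GRing.Additive.on diff_class.

Lemma diff_classP u v :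
  reflect (diff_class u = diff_class v) (ideal_val u - ideal_val v \in diff_ideal I).
Proof.
rewrite (_ : (_ \in _) = (u - v \in in_diff)) //.
by rewrite Quotient.idealrBE; apply: eqP.
Qed.

Lemma diff_reprK (x : ideal_mod_diff) :
  diff_class (repr (x : {ideal_quot in_diff})) = x.
Proof. exact: reprK. Qed.

Definition ideal_elt_mul (f : P) (u : ideal_elt) : ideal_elt :=
  IdealElt (idealMr f (ideal_valP u)).

(* For delta of order <= 1, delta (f g) - f delta(g) = g h with
   h := delta (f) - f delta(1). *)
Fact diffop1_mul (delta : P -> P) (f g : P) : diffop 1 delta ->
  delta (f * g) = f * delta g + g * (delta f - f * delta 1).
Proof.
case=> _ /(_ f) L; have Z := @diffop_zmod 0 _ L.
have L0 : delta (f * 0) - f * delta 0 = 0 by have := Z 0 0; rewrite !subrr.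
have := L g 1 0; rewrite /= L0 !addr0 => E; move: E.
rewrite /GRing.scale /= !mulr1 => <-.
by rewrite addrC subrK.
Qed.

Fact diff_ideal_mull (f g : P) : g \in I -> g \in diff_ideal I -> f * g \in diff_ideal I.
Proof.
move=> Ig /asboolP Dg; apply/asboolP => delta D; rewrite (diffop1_mul _ _ D).
by rewrite rpredD // 1?[g * _]mulrC idealMr // Dg.
Qed.

Fact diff_ideal_mulI (f g : P) : f \in I -> g \in I -> f * g \in diff_ideal I.
Proof.
move=> If Ig; apply/asboolP => delta D; rewrite (diffop1_mul _ _ D).
by rewrite [f * _]mulrC [g * _]mulrC rpredD // idealMr.
Qed.

Definition diff_scale (r : R) (x : ideal_mod_diff) : ideal_mod_diff :=
  diff_class (ideal_elt_mul (repr (r : {ideal_quot I})) (repr (x : {ideal_quot in_diff}))).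

Lemma diff_scaleE f u :
  diff_scale (coord_proj I f) (diff_class u) = diff_class (ideal_elt_mul f u).
Proof.
rewrite /diff_scale.
set g := repr _; set v := repr _.
have gf : g - f \in I by apply/coord_projP; rewrite coord_reprK.
have vu : ideal_val v - ideal_val u \in diff_ideal I.
  by apply/diff_classP; rewrite diff_reprK.
apply/diff_classP => /=.
have -> : g * v - f * u = ideal_val
    (IdealElt (idealMr g (ideal_valP (v - u))) +
     IdealElt (idealMr (ideal_val u) gf)).
  have -> : g * v - f * u = g * (ideal_val v - u) + ideal_val u * (g - f).
    by rewrite !mulrBr [_ * g]mulrC [_ * f]mulrC addrA subrK.
  by [].
apply: (rpredD (S := in_diff)).
  by apply: diff_ideal_mull vu; exact: (ideal_valP (v - u)).
by apply: diff_ideal_mulI gf; exact: ideal_valP.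
Qed.

Fact diff_scaleA r s x : diff_scale r (diff_scale s x) = diff_scale (r * s) x.
Proof.
rewrite -(coord_reprK r) -(coord_reprK s) -(diff_reprK x) -rmorphM !diff_scaleE.
by congr diff_class; apply: val_inj; rewrite /= mulrA.
Qed.

Fact diff_scale1 : left_id 1 diff_scale.
Proof.
move=> x; rewrite -(diff_reprK x) -(rmorph1 (coord_proj I)) diff_scaleE.
by congr diff_class; apply: val_inj; rewrite /= mul1r.
Qed.

Fact diff_scaleDr : right_distributive diff_scale +%R.
Proof.
move=> r x y; rewrite -(coord_reprK r) -(diff_reprK x) -(diff_reprK y).
rewrite -raddfD !diff_scaleE -raddfD.
by congr diff_class; apply: val_inj; rewrite /= mulrDr.
Qed.

Fact diff_scaleDl x : {morph diff_scale^~ x : r s / r + s}.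
Proof.
move=> r s; rewrite -(coord_reprK r) -(coord_reprK s) -(diff_reprK x).
rewrite -raddfD !diff_scaleE -raddfD.
by congr diff_class; apply: val_inj; rewrite /= mulrDl.
Qed.

HB.instance Definition _ := GRing.Zmodule_isLmodule.Build R ideal_mod_diff
  diff_scaleA diff_scale1 diff_scaleDr diff_scaleDl.

Lemma diff_classZ f u :
  coord_proj I f *: diff_class u = diff_class (ideal_elt_mul f u).
Proof. exact: diff_scaleE. Qed.

End IdealModDiff.

Section Kaehler.
Variables (K : fieldType) (R : comAlgType K).

Definition derivation (M : lmodType R) (D : R -> M) : Prop :=
  (forall (a : K) (r s : R), D (a *: r + s) = a%:A *: D r + D s) /\
  (forall r s : R, D (r * s) = r *: D s + s *: D r).

(* (Omega, d) is a module of Kaehler differentials of R/K together with its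
   universal derivation. *)
Definition kaehler_differentials (Omega : lmodType R) (d : R -> Omega) : Prop :=
  derivation d /\
  forall (M : lmodType R) (D : R -> M), derivation D ->
    exists2 phi : {linear Omega -> M},
      forall r, phi (d r) = D r &
      forall psi : {linear Omega -> M}, (forall r, psi (d r) = D r) -> psi =1 phi.

End Kaehler.

Section Gradings.

(* All modules below live in nonnegative degrees, so gradings are indexed by
   nat and given by their homogeneous components. *)
Definition graded_module (R : nzRingType) (RR : nat -> R -> Prop)
    (M : lmodType R) (MM : nat -> M -> Prop) : Prop :=
  [/\ forall k, MM k 0 /\ (forall u v, MM k u -> MM k v -> MM k (u - v)),
      forall i j r u, RR i r -> MM j u -> MM (i + j)%N (r *: u),
      forall u, exists N (s : nat -> M),
        (forall k, MM k (s k)) /\ u = \sum_(k < N) s k &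
      forall N (s : nat -> M), (forall k, MM k (s k)) ->
        \sum_(k < N) s k = 0 -> forall k, (k < N)%N -> s k = 0].

Definition graded_map (U V : Type) (UU : nat -> U -> Prop)
    (VV : nat -> V -> Prop) (f : U -> V) : Prop :=
  forall k u, UU k u -> VV k (f u).

Variables (K : fieldType) (n : nat) (I : idealr {mpoly K[n]}).
Local Notation R := (coord_ring I).

Definition coord_deg (k : nat) (r : R) : Prop :=
  exists2 f, f \is k.-homog & r = coord_proj I f.

Definition ideal_mod_diff_deg (k : nat) (x : ideal_mod_diff I) : Prop :=
  exists2 u : ideal_elt I, ideal_val u \is k.-homog & x = diff_class u.

(* The free module R^p(-1), whose canonical basis vectors are in degree 1. *)
Definition free_shift_deg (p k : nat) (v : 'rV[R]_p) : Prop :=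
  forall i, if k is k'.+1 then coord_deg k' (v 0 i) else v 0 i = 0.

(* Degree k is spanned by the r ds with r, s homogeneous, deg r + deg s = k. *)
Definition kaehler_deg (Omega : lmodType R) (d : R -> Omega)
    (k : nat) (w : Omega) : Prop :=
  exists N (r s : 'I_N -> R),
    (forall l, exists i j, [/\ coord_deg i (r l), coord_deg j (s l) & (i + j)%N = k])
    /\ w = \sum_l r l *: d (s l).

End Gradings.

Definition short_exact (R : nzRingType) (A B C : lmodType R)
    (f : {linear A -> B}) (g : {linear B -> C}) : Prop :=
  [/\ injective f,
      forall b, g b = 0 <-> exists a, f a = b &
      forall c, exists b, g b = c].

(* Main.v *)
(* Omega is the cokernel of the gradient map [delta : I/I^diff -> R^n]. The
   gradient induces a K-derivation of R with values in coker delta, so the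
   universal property yields Omega -> coker delta, and it is inverse to the map
   induced by [gamma], as both compositions fix the differentials of the
   coordinates. The map [delta] is injective because operators of order at most 1
   are [f0 + sum_i f_i d/dX_i], so that [f] in I lies in I^diff exactly when its
   partial derivatives lie in I. As I is homogeneous, all of this respects
   degrees, and the grading of Omega is inherited from that of R^n(-1). *)
Require Import Defs.
From HB Require Import structures.
From mathcomp Require Import all_boot all_algebra.
From mathcomp Require Import generic_quotient ring_quotient.
From mathcomp Require Import boolp mpoly.

Set Implicit Arguments.
Unset Strict Implicit.
Unset Printing Implicit Defensive.

Import GRing.Theory.

Local Open Scope ring_scope.

(** * Cokernels of linear maps *)

Section Cokernel.
Variables (R : nzRingType) (A B : lmodType R) (f : {linear A -> B}).

Definition in_image : {pred B} := fun b => `[< exists a, f a = b >].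

Lemma in_imageP b : reflect (exists a, f a = b) (b \in in_image).
Proof. exact: asboolP. Qed.

Fact in_image_zmod : zmod_closed in_image.
Proof.
split=> [|_ _ /in_imageP[a <-] /in_imageP[b <-]].
  by apply/in_imageP; exists 0; rewrite raddf0.
by apply/in_imageP; exists (a - b); rewrite raddfB.
Qed.
HB.instance Definition _ := GRing.isZmodClosed.Build B in_image in_image_zmod.

(** [ideal_quot] serves here as the quotient of an additive group by a subgroup; the scalars of [R]
    are put on it below. *)
Definition coker : Type := {ideal_quot in_image}.
HB.instance Definition _ := GRing.Zmodule.on coker.

Definition coker_proj : B -> coker := (\pi_{ideal_quot in_image})%qT.
HB.instance Definition _ := GRing.Additive.on coker_proj.

Lemma coker_projP b c : reflect (coker_proj b = coker_proj c) (b - c \in in_image).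
Proof. by rewrite Quotient.idealrBE; apply: eqP. Qed.

Lemma coker_proj_eq0 b : coker_proj b = 0 <-> exists a, f a = b.
Proof.
rewrite -(raddf0 coker_proj); split=> [/coker_projP|E].
  by rewrite subr0 => /in_imageP.
by apply/coker_projP; rewrite subr0; apply/in_imageP.
Qed.

Lemma coker_reprK (x : coker) : coker_proj (repr (x : {ideal_quot in_image})) = x.
Proof. exact: reprK. Qed.

Definition coker_scale (r : R) (x : coker) : coker :=
  coker_proj (r *: repr (x : {ideal_quot in_image})).

(** Two representatives differ by some [f a], and [r *: f a] is [f (r *: a)], again in the image. *)
Lemma coker_scaleE r b : coker_scale r (coker_proj b) = coker_proj (r *: b).
Proof.
apply/coker_projP; rewrite -scalerBr.
set c := repr _.
have /in_imageP[a <-] : c - b \in in_image by apply/coker_projP; rewrite coker_reprK.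
by apply/in_imageP; exists (r *: a); rewrite linearZ.
Qed.

Fact coker_scaleA r s x : coker_scale r (coker_scale s x) = coker_scale (r * s) x.
Proof. by rewrite -(coker_reprK x) !coker_scaleE scalerA. Qed.

Fact coker_scale1 : left_id 1 coker_scale.
Proof. by move=> x; rewrite -(coker_reprK x) coker_scaleE scale1r. Qed.

Fact coker_scaleDr : right_distributive coker_scale +%R.
Proof.
move=> r x y; rewrite -(coker_reprK x) -(coker_reprK y).
by rewrite -raddfD !coker_scaleE -raddfD scalerDr.
Qed.

Fact coker_scaleDl x : {morph coker_scale^~ x : r s / r + s}.
Proof.
by move=> r s; rewrite -(coker_reprK x) !coker_scaleE -raddfD scalerDl.
Qed.

HB.instance Definition _ := GRing.Zmodule_isLmodule.Build R coker
  coker_scaleA coker_scale1 coker_scaleDr coker_scaleDl.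

Lemma coker_projZ : scalable coker_proj.
Proof. by move=> r b; rewrite -coker_scaleE. Qed.
HB.instance Definition _ :=
  GRing.isScalable.Build R B coker _ coker_proj coker_projZ.

End Cokernel.

(** * Derivations of a polynomial ring along a ring morphism *)

Lemma mderiv_var (R : nzRingType) n (i j : 'I_n) :
  ('X_j)^`M(i) = (j == i)%:R :> {mpoly R[n]}.
Proof.
rewrite mderivX mnm1E; case: eqP => [->|_]; last by rewrite scale0r.
rewrite scale1r (_ : (_ - _)%MM = 0%MM) ?mpolyX0 //.
by apply/mnmP => l; rewrite mnmBE subnn mnm0E.
Qed.

Section PolynomialDerivation.
Variables (K : fieldType) (n : nat) (S : comNzRingType).
Variables (h : {rmorphism {mpoly K[n]} -> S}) (M : lmodType S).
Variable D : {mpoly K[n]} -> M.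
Hypothesis D_add : {morph D : f g / f + g}.
Hypothesis D_mul : forall f g, D (f * g) = h f *: D g + h g *: D f.
Hypothesis D_const : forall c, D c%:MP = 0.

(* The defect [E] of the formula is again a derivation; it kills constants and
   variables, hence everything. *)
Lemma mpoly_derivationE f : D f = \sum_(i < n) h f^`M(i) *: D 'X_i.
Proof.
pose E g := D g - \sum_(i < n) h g^`M(i) *: D 'X_i.
suff E0 g : E g = 0 by apply/eqP; rewrite -subr_eq0 -/(E f) E0.
have EC c : E c%:MP = 0.
  by rewrite /E D_const big1 ?subr0 // => i _; rewrite mderivC rmorph0 scale0r.
have EX i : E 'X_i = 0.
  rewrite /E (bigD1 i) //= big1 ?addr0 => [|j ji]; rewrite mderiv_var.
    by rewrite eqxx rmorph1 scale1r subrr.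
  by rewrite eq_sym (negPf ji) rmorph0 scale0r.
have EM p q : E p = 0 -> E q = 0 -> E (p * q) = 0.
  move=> /eqP; rewrite subr_eq0 => /eqP Ep /eqP; rewrite subr_eq0 => /eqP Eq.
  apply/eqP; rewrite subr_eq0 D_mul Ep Eq !scaler_sumr -big_split /=.
  apply/eqP/eq_bigr => i _; rewrite mderivM !scalerA -scalerDl rmorphD !rmorphM.
  by rewrite addrC [h q * _]mulrC.
have E1 : E 1 = 0 by rewrite -mpolyC1 EC.
have EMon m : E 'X_[m] = 0.
  rewrite mpolyXE_id; apply: (big_ind (fun p => E p = 0)) => // i _.
  by elim: (m i) => [|k IHk]; rewrite ?expr0 // exprS EM.
elim/mpolyind: g => [|c m p _ _ IHp]; first by rewrite -mpolyC0 EC.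
(* [D] comes with additivity and a Leibniz rule, so the scalar is turned into a constant factor, to
   which [EM] and [EC] apply. *)
have -> : E (c *: 'X_[m] + p) = E (c%:MP * 'X_[m]) + E p.
  rewrite /E mul_mpolyC D_add addrACA -opprD -big_split /=; congr (_ - _).
  by apply: eq_bigr => i _; rewrite mderivD rmorphD scalerDl.
by rewrite EM // IHp addr0.
Qed.

End PolynomialDerivation.

(** * Homogeneous components and partial derivatives *)

Section Components.
Variables (K : fieldType) (n : nat).
Local Notation P := {mpoly K[n]}.

Lemma mcoeff_pihomog k (f : P) m :
  (pihomog mdeg k f)@_m = if mdeg m == k then f@_m else 0.
Proof.
elim/mpolyind: f => [|c m' p _ _ IHp]; first by rewrite raddf0 mcoeff0 if_same.
rewrite pihomogD linearZ !mcoeffD IHp /= !mcoeffZ pihomogX.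
case: (eqVneq m' m) => [->|ne]; first by case: ifP; rewrite ?mcoeff0 ?mulr0 ?addr0.
have X0 : 'X_[m']@_m = 0 :> K by rewrite mcoeffX (negPf ne).
by rewrite X0 mulr0; case: ifP; case: ifP; rewrite ?X0 ?mcoeff0 ?mulr0 ?add0r.
Qed.

(** The coefficient of the derivative at [m] is a multiple of the one of [f] at [m + U_(i)], a
    monomial of degree one more. *)
Lemma mderiv_pihomog k (f : P) i :
  (pihomog mdeg k.+1 f)^`M(i) = pihomog mdeg k f^`M(i).
Proof.
apply/mpolyP => m; rewrite mcoeff_mderiv !mcoeff_pihomog mcoeff_mderiv.
by rewrite mdegD mdeg1 addn1 eqSS; case: ifP => //; rewrite mul0rn.
Qed.

Lemma mderiv_homog k (f : P) i : f \is k.+1.-homog -> f^`M(i) \is k.-homog.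
Proof. by move=> /pihomog_dE <-; rewrite mderiv_pihomog pihomogP. Qed.

(** Degree 0 is separate because the derivative would have degree -1, which natural numbers cannot
    index. *)
Lemma mderiv_homog0 (f : P) i : f \is 0.-homog -> f^`M(i) = 0.
Proof.
move=> /pihomog_dE <-; apply/mpolyP => m.
by rewrite mcoeff_mderiv mcoeff_pihomog mdegD mdeg1 addn1 mul0rn mcoeff0.
Qed.

End Components.

(** * The gradient on I/I^diff and the derivation into its cokernel *)

Section ConormalMap.
Variables (K : fieldType) (n : nat) (I : idealr {mpoly K[n]}).
Local Notation P := {mpoly K[n]}.
Local Notation R := (coord_ring I).

Lemma coord_proj_eq0 f : coord_proj I f = 0 <-> f \in I.
Proof.
rewrite -(rmorph0 (coord_proj I)).
by split=> [/coord_projP|fI]; [|apply/coord_projP]; rewrite subr0.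
Qed.

Lemma diffop1_id : diffop 1 (@id P).
Proof.
by split=> [//|f] a g h; rewrite /= !subrr scaler0 addr0.
Qed.

Lemma diffop1_mderiv i : diffop 1 (@mderiv n K i : P -> P).
Proof.
split=> [|f a g h] /=; first exact: linearP.
rewrite !mderivM !addrK mulrDr; congr (_ + _).
by rewrite /GRing.scale /= mulrCA.
Qed.

(* An operator of order at most 1 is a multiplication plus a derivation. *)
Lemma diff_idealP f :
  f \in diff_ideal I <-> f \in I /\ forall i, f^`M(i) \in I.
Proof.
split=> [/asboolP Df|[fI dfI]].
  by split=> [|i]; [exact: Df diffop1_id | exact: Df (diffop1_mderiv i)].
(* Subtracting multiplication by [delta 1] makes the operator vanish on constants and leaves a
   derivation of the polynomial ring. *)
apply/asboolP => delta D; pose E g := delta g - g * delta 1.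
have L : linear delta by case: D.
have EE := @mpoly_derivationE K n P idfun P^o E.
have {}EE : E f = \sum_(i < n) f^`M(i) * E 'X_i.
  apply: EE => [g h|g h|c].
  - rewrite /E mulrDl; have := L 1 g h; rewrite !scale1r => ->.
    by rewrite opprD addrACA.
  - rewrite /E (diffop1_mul _ _ D) /= /GRing.scale /=.
    by rewrite [g * (_ - _)]mulrBr mulrA addrAC.
  - have d0 : delta 0 = 0 by have := diffop_zmod D 0 0; rewrite !subrr.
    have := L c 1 0; rewrite d0 !addr0 -!mul_mpolyC mulr1 /E => ->.
    exact: subrr.
have -> : delta f = E f + f * delta 1 by rewrite subrK.
rewrite EE rpredD ?rpred_sum // => [i _|]; by rewrite mulrC idealMr.
Qed.

(** The domain is all of [P] rather than [I], since the same row also defines a derivation of [R]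
    modulo gradients of elements of [I]. *)
Definition gradient (f : P) : 'rV[R]_n := \row_i coord_deriv I f i.

Lemma gradientB f g : gradient (f - g) = gradient f - gradient g.
Proof. by apply/rowP => i; rewrite !mxE /coord_deriv mderivB rmorphB. Qed.

Lemma gradientD f g : gradient (f + g) = gradient f + gradient g.
Proof. by apply/rowP => i; rewrite !mxE /coord_deriv mderivD rmorphD. Qed.

Lemma gradientM f g :
  gradient (f * g) = coord_proj I f *: gradient g + coord_proj I g *: gradient f.
Proof.
apply/rowP => i; rewrite !mxE /coord_deriv mderivM rmorphD !rmorphM.
by rewrite addrC [coord_proj I g * _]mulrC.
Qed.

Lemma gradientC c : gradient c%:MP = 0.
Proof. by apply/rowP => i; rewrite !mxE /coord_deriv mderivC rmorph0. Qed.

Lemma gradientX i : gradient 'X_i = delta_mx 0 i.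
Proof.
by apply/rowP => j; rewrite !mxE /coord_deriv mderiv_var eq_sym rmorph_nat.
Qed.

(** One direction makes the gradient well defined on I/I^diff, the other makes it injective
    there. *)
Lemma gradient_diff_ideal f : f \in I -> gradient f = 0 <-> f \in diff_ideal I.
Proof.
move=> fI; rewrite diff_idealP; split=> [/rowP E|[_ df]].
  by split=> // i; apply/coord_proj_eq0; have := E i; rewrite !mxE.
by apply/rowP => i; rewrite !mxE; apply/coord_proj_eq0.
Qed.

(** The classical conormal map from I/I^2 to R^n, with its kernel I^diff/I^2 divided out. *)
Definition conormal (x : ideal_mod_diff I) : 'rV[R]_n :=
  gradient (ideal_val (repr (x : {ideal_quot (@in_diff K n I)}))).

Lemma conormalE u : conormal (diff_class u) = gradient (ideal_val u).
Proof.
rewrite /conormal; set v := repr _.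
have vu : ideal_val v - ideal_val u \in diff_ideal I.
  by apply/diff_classP; rewrite diff_reprK.
apply/eqP; rewrite -subr_eq0 -gradientB; apply/eqP.
by apply/gradient_diff_ideal => //; rewrite rpredB // ideal_valP.
Qed.

Fact conormal_linear : linear conormal.
Proof.
move=> r x y; rewrite -(coord_reprK r) -(diff_reprK x) -(diff_reprK y).
rewrite diff_classZ -raddfD !conormalE gradientD gradientM.
(* The Leibniz rule leaves an extra term with the class of an element of [I] as factor, and this
   class is 0. *)
have /coord_proj_eq0-> := ideal_valP (repr (x : {ideal_quot (@in_diff K n I)})).
by rewrite scale0r addr0.
Qed.
HB.instance Definition _ :=
  GRing.isLinear.Build R (ideal_mod_diff I) 'rV[R]_n _ conormal conormal_linear.

Lemma conormal_inj : injective conormal.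
Proof.
apply: raddf_inj => x; rewrite -(diff_reprK x) /= conormalE.
move/gradient_diff_ideal => /(_ (ideal_valP _)) D.
by rewrite -(raddf0 (@diff_class K n I)); apply/diff_classP; rewrite subr0.
Qed.

Definition coker_deriv (r : R) : coker conormal :=
  coker_proj conormal (gradient (repr (r : {ideal_quot I}))).

(** Another representative changes the gradient by that of an element of [I], which lies in the
    image of [conormal]. *)
Lemma coker_derivE f : coker_deriv (coord_proj I f) = coker_proj conormal (gradient f).
Proof.
apply/coker_projP; rewrite -gradientB.
set g := repr _.
have gf : g - f \in I by apply/coord_projP; rewrite coord_reprK.
by apply/in_imageP; exists (diff_class (IdealElt gf)); rewrite /= conormalE.
Qed.

Lemma coker_deriv_derivation : derivation coker_deriv.
Proof.
split=> [a r s|r s]; rewrite -(coord_reprK r) -(coord_reprK s).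
  (* A scalar of [K] acts as the class of a constant polynomial, whose gradient is 0, so the Leibniz
     rule covers it. *)
  rewrite !coord_scaleE mulr1 -rmorphM -rmorphD !coker_derivE.
  by rewrite gradientD gradientM gradientC scaler0 addr0 raddfD /= coker_projZ.
by rewrite -rmorphM !coker_derivE gradientM raddfD /= !coker_projZ.
Qed.

End ConormalMap.

(** * The presentation of Omega by the differentials of the coordinates *)

Section KaehlerPresentation.
Variables (K : fieldType) (n : nat) (I : idealr {mpoly K[n]}).
Local Notation P := {mpoly K[n]}.
Local Notation R := (coord_ring I).
Variables (Omega : lmodType R) (d : R -> Omega).

Definition coord_differential (v : 'rV[R]_n) : Omega :=
  \sum_(i < n) v 0 i *: d (coord_var I i).

Fact coord_differential_linear : linear coord_differential.
Proof.
move=> r v w; rewrite /coord_differential scaler_sumr -big_split /=.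
by apply: eq_bigr => i _; rewrite !mxE scalerDl scalerA.
Qed.
HB.instance Definition _ :=
  GRing.isLinear.Build R 'rV[R]_n Omega _ coord_differential coord_differential_linear.

Lemma coord_differential_delta i :
  coord_differential (delta_mx 0 i) = d (coord_var I i).
Proof.
rewrite /coord_differential (bigD1 i) //= mxE !eqxx scale1r.
by rewrite big1 ?addr0 // => j ji; rewrite mxE (negPf ji) scale0r.
Qed.

Hypothesis dK : kaehler_differentials d.

(** The composite of [d] with the projection from [P] is a derivation killing constants, hence
    determined by its values on the variables. *)
Lemma coord_differential_gradient f :
  coord_differential (gradient I f) = d (coord_proj I f).
Proof.
have [[dZ dM] _] := dK.
have d0 : d 0 = 0 by have := dM 0 0; rewrite !mul0r !scale0r addr0.
have dD r s : d (r + s) = d r + d s by have := dZ 1 r s; rewrite !scale1r.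
have d1 : d 1 = 0.
  by apply/(addrI (d 1)); rewrite addr0; have := dM 1 1; rewrite mulr1 scale1r => {1}<-.
have dC c : d (coord_proj I c%:MP) = 0.
  have := dZ c 1 0; rewrite addr0 d1 d0 scaler0 addr0 => <-.
  by rewrite coord_scaleE mulr1.
have -> : d (coord_proj I f) = \sum_(i < n) coord_proj I f^`M(i) *: d (coord_var I i).
  apply: (@mpoly_derivationE _ _ _ (coord_proj I) Omega (fun g => d (coord_proj I g))).
  - by move=> g h; rewrite rmorphD dD.
  - by move=> g h; rewrite rmorphM dM.
  - exact: dC.
by apply: eq_bigr => i _; rewrite mxE.
Qed.

Lemma coord_differential_conormal x : coord_differential (@conormal K n I x) = 0.
Proof.
rewrite -(diff_reprK x) conormalE coord_differential_gradient.
have /coord_proj_eq0-> := ideal_valP (repr (x : {ideal_quot (@in_diff K n I)})).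
by have [[_ dM] _] := dK; have := dM 0 0; rewrite !mul0r !scale0r addr0.
Qed.

(** The map [g] induced on the cokernel, composed after [phi], fixes every [d r]; by uniqueness it
    is the identity, so [w] is a value of [g]. *)
Lemma coord_differential_surj w : exists v, coord_differential v = w.
Proof.
have [d_der univ] := dK.
have [phi phiE _] := univ _ _ (@coker_deriv_derivation K n I).
pose g (x : coker (@conormal K n I)) :=
  coord_differential (repr (x : {ideal_quot (in_image (@conormal K n I))})).
have gE v : g (coker_proj _ v) = coord_differential v.
  apply/eqP; rewrite -subr_eq0 -raddfB; apply/eqP.
  set v' := repr _.
  have /in_imageP[x <-] : v' - v \in in_image (@conormal K n I).
    by apply/coker_projP; rewrite coker_reprK.
  exact: coord_differential_conormal.
have g_lin : linear g.
  move=> r x y; rewrite -(coker_reprK x) -(coker_reprK y).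
  by rewrite -coker_projZ -raddfD !gE linearP.
pose gL := GRing.isLinear.Build R (coker (@conormal K n I)) Omega _ g g_lin.
pose gl : {linear coker (@conormal K n I) -> Omega} := HB.pack g gL.
(* Uniqueness compares a map with the one supplied by the universal property; [chi], obtained for
   [d] itself, links the identity to [g \o phi]. *)
have [chi _ chi_uniq] := univ _ _ d_der.
have -> : w = g (phi w).
  transitivity (chi w).
    by have := chi_uniq (idfun : {linear Omega -> Omega}) (fun=> erefl) w.
  symmetry; apply: (chi_uniq (gl \o phi : {linear Omega -> Omega})) => r /=.
  rewrite phiE -(coord_reprK r) coker_derivE.
  by rewrite [LHS]gE coord_differential_gradient.
by eexists.
Qed.

Lemma coord_differential_ker v :
  coord_differential v = 0 <-> exists x, @conormal K n I x = v.
Proof.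
have [d_der univ] := dK; split=> [v0|[x <-]].
  apply/coker_proj_eq0.
  have [phi phiE _] := univ _ _ (@coker_deriv_derivation K n I).
  have : phi (coord_differential v) = 0 by rewrite v0 raddf0.
  (* [phi] sends each dx_i to the class of e_i, so [phi (coord_differential v)] is the class of [v]
     in the cokernel. *)
  rewrite raddf_sum => <-; rewrite {1}(row_sum_delta v) raddf_sum.
  apply: eq_bigr => i _; rewrite /= coker_projZ linearZ /=; congr (_ *: _).
  by rewrite phiE coker_derivE gradientX.
exact: coord_differential_conormal.
Qed.

End KaehlerPresentation.

(** * Gradings of the three modules and degrees of the maps *)

Section Gradings.
Variables (K : fieldType) (n : nat) (I : idealr {mpoly K[n]}).
Local Notation P := {mpoly K[n]}.
Local Notation R := (coord_ring I).

Lemma coord_deg0 k : coord_deg k (0 : R).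
Proof. by exists 0; rewrite ?rmorph0 // dhomog0. Qed.

Lemma coord_degB k (r s : R) : coord_deg k r -> coord_deg k s -> coord_deg k (r - s).
Proof.
move=> [f hf ->] [g hg ->]; exists (f - g); last by rewrite rmorphB.
exact: rpredB.
Qed.

Lemma coord_degM i j (r s : R) :
  coord_deg i r -> coord_deg j s -> coord_deg (i + j) (r * s).
Proof.
move=> [f hf ->] [g hg ->]; exists (f * g); last by rewrite rmorphM.
exact: dhomogM.
Qed.

Lemma free_shift_deg0 k : free_shift_deg k (0 : 'rV[R]_n).
Proof. by move=> i; case: k => [|k]; rewrite mxE //; exact: coord_deg0. Qed.

Lemma free_shift_degB k (v w : 'rV[R]_n) :
  free_shift_deg k v -> free_shift_deg k w -> free_shift_deg k (v - w).
Proof.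
case: k => [|k] hv hw i; have := hv i; have := hw i; rewrite !mxE.
  by move=> -> ->; rewrite subr0.
by move=> hwi hvi; exact: coord_degB.
Qed.

Lemma free_shift_degZ i j (r : R) (v : 'rV[R]_n) :
  coord_deg i r -> free_shift_deg j v -> free_shift_deg (i + j) (r *: v).
Proof.
case: j => [|j] hr hv l; have := hv l; last first.
  by rewrite addnS mxE; exact: coord_degM.
(* For [j = 0] the entry of [v] is 0, and 0 must be seen to be admissible in degree [i], whether or
   not [i] is 0. *)
rewrite addn0 mxE => ->; rewrite mulr0.
by case: i {hr} => // i; exact: coord_deg0.
Qed.

(** Differentiation lowers the degree by one, and the shift by -1 makes up for it. *)
Lemma gradient_deg k f : f \is k.-homog -> free_shift_deg k (gradient I f).
Proof.
case: k => [|k] hf i; rewrite mxE /coord_deriv; first by rewrite mderiv_homog0 ?rmorph0.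
by exists f^`M(i); first exact: mderiv_homog.
Qed.

Lemma free_shift_deg_sum (v : 'rV[R]_n) :
  exists N (s : nat -> 'rV[R]_n),
    (forall k, free_shift_deg k (s k)) /\ v = \sum_(k < N) s k.
Proof.
pose f i : P := repr (v 0 i : {ideal_quot I}).
(* [msize] exceeds the degree, so the components below [N] exhaust every entry; the shift moves them
   to the degrees from 1 to [N]. *)
pose N := (\max_i msize (f i))%N.
exists N.+1, (fun k => if k is k'.+1 then
  \row_i coord_proj I (pihomog mdeg k' (f i)) else 0); split=> [[|k] i|].
- by rewrite mxE.
- by rewrite mxE; exists (pihomog mdeg k (f i)); first exact: pihomogP.
rewrite big_ord_recl add0r; apply/rowP => i; rewrite summxE.
rewrite -[LHS]coord_reprK -/(f i) {1}(@pihomog_partitionE _ _ mdeg N (f i)) ?raddf_sum; last first.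
  exact: (leq_bigmax (F := fun i => msize (f i))).
by apply: eq_bigr => k _; rewrite mxE.
Qed.

Lemma conormal_graded :
  graded_map (ideal_mod_diff_deg (I := I)) (free_shift_deg (I := I) (p := n))
    (@conormal K n I).
Proof. by move=> k _ [u hu ->]; rewrite conormalE; exact: gradient_deg. Qed.

Hypothesis homI : homogeneous_ideal I.

Definition coord_component k (r : R) : R :=
  coord_proj I (pihomog mdeg k (repr (r : {ideal_quot I}))).

(** Two representatives differ by an element of [I], whose components lie in [I] by homogeneity. *)
Lemma coord_componentE k f :
  coord_component k (coord_proj I f) = coord_proj I (pihomog mdeg k f).
Proof.
apply/coord_projP; rewrite -raddfB; apply: homI.
by apply/coord_projP; rewrite coord_reprK.
Qed.

Fact coord_component_zmod k : zmod_morphism (coord_component k).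
Proof.
move=> r s; rewrite -(coord_reprK r) -(coord_reprK s).
by rewrite -raddfB !coord_componentE -raddfB -raddfB.
Qed.

Definition free_component k (v : 'rV[R]_n) : 'rV[R]_n :=
  if k is k'.+1 then \row_i coord_component k' (v 0 i) else 0.

Fact free_component_zmod k : zmod_morphism (free_component k).
Proof.
case: k => [|k] v w /=; first by rewrite subr0.
by apply/rowP => i; rewrite !mxE coord_component_zmod.
Qed.

Lemma free_component_deg j k v : free_shift_deg k v ->
  free_component j v = if j == k then v else 0.
Proof.
case: j k => [|j] [|k] hv //=; apply/rowP => i; have := hv i; rewrite !mxE.
- by move=> ->.
- by move=> ->; rewrite -(rmorph0 (coord_proj I)) coord_componentE raddf0.
move=> [f hf E]; rewrite E coord_componentE eqSS; case: eqVneq => [->|jk].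
  by rewrite E pihomog_dE.
by rewrite (pihomog_ne0 _ hf) 1?eq_sym // mxE rmorph0.
Qed.

(** Recovering each summand from the sum is what makes homogeneous decompositions unique. *)
Lemma free_component_sum N (s : nat -> 'rV[R]_n) k :
  (forall j, free_shift_deg j (s j)) -> (k < N)%N ->
  free_component k (\sum_(j < N) s j) = s k.
Proof.
move=> hs kN.
pose F := GRing.isZmodMorphism.Build _ _ (free_component k) (free_component_zmod k).
pose c : {additive 'rV[R]_n -> 'rV[R]_n} := HB.pack (free_component k) F.
rewrite -[free_component k]/(c : _ -> _) raddf_sum (bigD1 (Ordinal kN)) //=.
rewrite (free_component_deg _ (hs k)) eqxx big1 ?addr0 // => j.
by rewrite -val_eqE /= eq_sym (free_component_deg _ (hs j)) => /negPf->.
Qed.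

(** This makes the image of [conormal] a graded submodule. *)
Lemma free_component_gradient k f :
  free_component k (gradient I f) = gradient I (pihomog mdeg k f).
Proof.
apply/rowP => i; case: k => [|k]; rewrite !mxE /coord_deriv.
  by rewrite mderiv_homog0 ?rmorph0 // pihomogP.
by rewrite coord_componentE mderiv_pihomog.
Qed.

Lemma graded_free_shift :
  graded_module (coord_deg (I := I)) (free_shift_deg (I := I) (p := n)).
Proof.
split=> [k|i j r v|v|N s hs s0 k kN].
- by split; [exact: free_shift_deg0 | exact: free_shift_degB].
- exact: free_shift_degZ.
- exact: free_shift_deg_sum.
rewrite -(free_component_sum hs kN) s0.
by have := free_component_zmod k 0 0; rewrite !subrr.
Qed.

Lemma graded_ideal_mod_diff :
  graded_module (coord_deg (I := I)) (ideal_mod_diff_deg (I := I)).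
Proof.
split=> [k|i j _ _ [f hf ->] [u hu ->]|x|N s hs s0 k kN].
- split=> [|_ _ [u hu ->] [v hv ->]].
    by exists 0; [exact: dhomog0 | rewrite raddf0].
  by exists (u - v); [exact: rpredB | rewrite raddfB].
- exists (ideal_elt_mul f u); [exact: dhomogM | exact: diff_classZ].
- rewrite -(diff_reprK x); set u := repr _.
  pose c k : ideal_elt I := IdealElt (homI k (ideal_valP u)).
  exists (msize (ideal_val u)), (fun k => diff_class (c k)); split=> [k|].
    by exists (c k) => //; exact: pihomogP.
  rewrite -raddf_sum; congr diff_class; apply: val_inj.
  by rewrite raddf_sum; exact: pihomog_partitionE.
(* Uniqueness is pulled back from the free module along the injective graded map [conormal]. *)
apply: conormal_inj; rewrite raddf0.
have [_ _ _ /(_ N (fun k => conormal (s k)))] := graded_free_shift.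
apply=> // [j|]; first exact: conormal_graded.
by rewrite -raddf_sum s0 raddf0.
Qed.

Variables (Omega : lmodType R) (d : R -> Omega).
Hypothesis dK : kaehler_differentials d.

(** The grading of Omega is the image of that of R^n(-1): for a form [g] representing s, r ds is the
    image of [r *: gradient I g], of the same degree. *)
Lemma kaehler_degP k w : kaehler_deg d k w <->
  exists2 v : 'rV[R]_n, free_shift_deg k v & coord_differential d v = w.
Proof.
split=> [[N [r [s [hrs ->]]]]|[v hv <-]].
  pose f l : P := repr (s l : {ideal_quot I}).
  have /boolp.choice[v hv] l : exists v : 'rV[R]_n,
      free_shift_deg k v /\ coord_differential d v = r l *: d (s l).
    have [i [j [hr [g hg ->] <-]]] := hrs l.
    exists (r l *: gradient I g); split.
      by apply: free_shift_degZ => //; exact: gradient_deg.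
    by rewrite linearZ /= coord_differential_gradient.
  exists (\sum_l v l); last by rewrite raddf_sum; apply: eq_bigr => l _; case: (hv l).
  elim/big_ind: _ => [|v1 v2 h1 h2|l _]; last by case: (hv l).
    exact: free_shift_deg0.
  rewrite -[v2]opprK; apply: free_shift_degB => //.
  by rewrite -[- v2]sub0r; apply: free_shift_degB => //; exact: free_shift_deg0.
case: k hv => [|k] hv.
  (* In degree 0 the vector [v] is 0, so the empty sum represents its image. *)
  exists 0%N, (fun=> 0), (fun=> 0); split=> [[]//|].
  rewrite big_ord0 (_ : v = 0) ?raddf0 //.
  by apply/rowP => i; rewrite (hv i) mxE.
exists n, (fun i => v 0 i), (fun i => coord_var I i); split=> // i.
exists k, 1%N; split; [exact: hv| |exact: addn1].
by exists 'X_i => //; rewrite dhomogX /= mdeg1.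
Qed.

Lemma coord_differential_graded :
  graded_map (free_shift_deg (I := I) (p := n)) (kaehler_deg d)
    (coord_differential d).
Proof. by move=> k v hv; apply/kaehler_degP; exists v. Qed.

(** The kernel consists of gradients of elements of [I], and the components of such elements stay in
    [I]. *)
Lemma coord_differential_component k v :
  coord_differential d v = 0 -> coord_differential d (free_component k v) = 0.
Proof.
move=> /(coord_differential_ker dK)[x <-]; rewrite -(diff_reprK x) conormalE.
set u := repr _; rewrite free_component_gradient.
have -> : pihomog mdeg k (ideal_val u) = ideal_val (IdealElt (homI k (ideal_valP u))).
  by [].
by rewrite -conormalE coord_differential_conormal.
Qed.

Lemma graded_kaehler : graded_module (coord_deg (I := I)) (kaehler_deg d).
Proof.
split=> [k|i j r _ hr /kaehler_degP[v hv <-]|w|N s hs s0 k kN].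
- split=> [|_ _ /kaehler_degP[v hv <-] /kaehler_degP[w hw <-]]; apply/kaehler_degP.
    by exists 0; [exact: free_shift_deg0 | rewrite raddf0].
  by exists (v - w); [exact: free_shift_degB | rewrite raddfB].
- by apply/kaehler_degP; exists (r *: v); [exact: free_shift_degZ | rewrite linearZ].
- have [v <-] := coord_differential_surj dK w.
  have [N [s [hs ->]]] := free_shift_deg_sum v.
  exists N, (fun k => coord_differential d (s k)); split; last exact: raddf_sum.
  by move=> k; exact: coord_differential_graded.
(* Each [s j] is lifted to a vector of degree [j]. The sum of the lifts lies in the kernel, hence so
   does its component of degree [k], which is the lift of [s k]. *)
have /boolp.choice[v hv] j : exists v : 'rV[R]_n,
    free_shift_deg j v /\ coord_differential d v = s j.
  by have /kaehler_degP[v] := hs j; exists v.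
have hv1 j := (hv j).1.
rewrite -(hv k).2 -(free_component_sum hv1 kN).
apply: coord_differential_component; rewrite raddf_sum -[RHS]s0.
by apply: eq_bigr => j _; case: (hv j).
Qed.

End Gradings.

Theorem theorem1p3 (K : fieldType) (n : nat) (IX : idealr {mpoly K[n.+1]})
    (Omega : lmodType (coord_ring IX)) (d : coord_ring IX -> Omega) :
  perfect_field K ->
  (1 <= n)%N ->
  homogeneous_ideal IX ->
  saturated_ideal IX ->
  proj_dim0 IX ->
  kaehler_differentials d ->
  [/\ graded_module (coord_deg (I := IX)) (ideal_mod_diff_deg (I := IX)),
      graded_module (coord_deg (I := IX)) (free_shift_deg (I := IX) (p := n.+1)) &
      graded_module (coord_deg (I := IX)) (kaehler_deg d)] /\
  exists (delta : {linear ideal_mod_diff IX -> 'rV[coord_ring IX]_n.+1})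
         (gamma : {linear 'rV[coord_ring IX]_n.+1 -> Omega}),
    [/\ forall (u : ideal_elt IX) (k : nat), ideal_val u \is k.-homog ->
          delta (diff_class u) =
            \sum_(i < n.+1) coord_deriv IX (ideal_val u) i *: delta_mx 0 i,
        forall i : 'I_n.+1, gamma (delta_mx 0 i) = d (coord_var IX i),
        graded_map (ideal_mod_diff_deg (I := IX))
                   (free_shift_deg (I := IX) (p := n.+1)) delta,
        graded_map (free_shift_deg (I := IX) (p := n.+1)) (kaehler_deg d) gamma &
        short_exact delta gamma].
Proof.
move=> _ _ homI _ _ dK; split.
  split; [exact: graded_ideal_mod_diff | exact: graded_free_shift |].
  exact: graded_kaehler.
exists (@conormal K n.+1 IX), (coord_differential d); split.
- move=> u k _; rewrite /= conormalE [LHS]row_sum_delta.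
  by apply: eq_bigr => i _; rewrite mxE.
- exact: coord_differential_delta.
- exact: conormal_graded.
- exact: coord_differential_graded.
split; [exact: conormal_inj | exact: coord_differential_ker |].
exact: coord_differential_surj.
Qed.
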